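(* Let $n\ge 1$, $\lambda>0$ and $\sigma_1\ge\dots\ge\sigma_{n-1}\ge 1$, let $\mu$ be the Lorentzian inner product $\operatorname{diag}\{\sigma_1,\sigma_1,\dots,\sigma_{n-1},\sigma_{n-1},1,1,-\lambda\}$ on the Heisenberg Lie algebra $\mathfrak{h}_{2n+1}$ in the basis $\{f_1,g_1,\dots,f_n,g_n,z\}$, and let $\mathscr{B}=\{v_1,\dots,v_{2n+1}\}$ be the orthonormal basis given by $v_{2k-1}=\frac{1}{\sqrt{\sigma_k}}f_k$, $v_{2k}=\frac{1}{\sqrt{\sigma_k}}g_k$ for $1\le k\le n-1$, $v_{2n-1}=f_n$, $v_{2n}=g_n$, $v_{2n+1}=\frac{1}{\sqrt{\lambda}}z$. Then $\mu$ is an algebraic Ricci soliton if and only if $$\sigma_1=\sigma_2=\dots=\sigma_{n-1}=1.$$ In this case the Ricci operator is represented in the basis $\mathscr{B}$ by $$\operatorname{Ric}=\operatorname{diag}\left\{\frac{\lambda}{2},\frac{\lambda}{2},\dots,\frac{\lambda}{2},\frac{-n\lambda}{2}\right\},$$ and the algebraic Ricci soliton equation is $$\operatorname{Ric}=\frac{(n+2)\lambda}{2}I_{2n+1}+D,$$ where $$D=\operatorname{diag}\left\{\frac{-(n+1)\lambda}{2},\frac{-(n+1)\lambda}{2},\dots,\frac{-(n+1)\lambda}{2},-(n+1)\lambda\right\}$$ is (with respect to the orthonormal basis $\mathscr{B}$) a derivation of $\mathfrak{h}_{2n+1}$.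
   Context: The Heisenberg Lie algebra $\mathfrak{h}_{2n+1}$ is the real Lie algebra with basis $\{f_1,g_1,\dots,f_n,g_n,z\}$ whose only nonzero brackets of basis elements (up to antisymmetry) are $[f_i,g_i]=z$, $i=1,\dots,n$. For $n=1$ there are no $\sigma_k$ (the condition on them is vacuous). A Lorentzian inner product is a nondegenerate symmetric bilinear form of signature $(2n,1)$; an orthonormal basis $\{v_1,\dots,v_m\}$ satisfies $\langle v_i,v_j\rangle=0$ for $i\ne j$, $\langle v_i,v_i\rangle=1$ for $i<m$, and $\langle v_m,v_m\rangle=-1$. The Levi-Civita connection of $(\mathfrak{g},\langle\cdot,\cdot\rangle)$ is the bilinear map $(u,v)\mapsto\nabla_uv$ on $\mathfrak{g}$ determined by the Koszul formula $2\langle\nabla_uv,w\rangle=\langle[u,v],w\rangle+\langle[w,u],v\rangle+\langle[w,v],u\rangle$. The curvature is $R_{uv}w=\nabla_{[u,v]}w-\nabla_u\nabla_vw+\nabla_v\nabla_uw$, and the Ricci operator is $\operatorname{Ric}(u)=\sum_{k=1}^{m}\langle v_k,v_k\rangle R_{v_ku}v_k$ for an orthonormal basis $\{v_1,\dots,v_m\}$. A Lorentzian inner product on a Lie algebra $\mathfrak{g}$ is an algebraic Ricci soliton if $\operatorname{Ric}=\eta\operatorname{Id}_{\mathfrak{g}}+D$ for some $\eta\in\mathbb{R}$ and some derivation $D$ of $\mathfrak{g}$, i.e. a linear map with $[D(u),v]+[u,D(v)]=D[u,v]$ for all $u,v\in\mathfrak{g}$. *)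

(* Defs.v *)
From HB Require Import structures.
From mathcomp Require Import all_boot all_order all_algebra.
From mathcomp Require Import sesquilinear reals ring.

Set Implicit Arguments.
Unset Strict Implicit.
Unset Printing Implicit Defensive.

Import Order.TTheory GRing.Theory Num.Theory.
Local Open Scope ring_scope.

Section LorentzianLieAlgebras.
Variables (R : realType) (d : nat).

(* The carrier of a (d + 1)-dimensional real Lie algebra; d + 1 is spelled
   with a successor so that there is a last basis index, the timelike one. *)
Local Notation V := 'rV[R]_d.+1.
Implicit Types (br : V -> V -> V) (mu : V -> V -> R) (e : 'I_d.+1 -> V).

Definition lie_bracket br : Prop :=
  [/\ bilinear_for *:%R *:%R br, forall x, br x x = 0
    & forall x y z, br x (br y z) + br y (br z x) + br z (br x y) = 0].

Definition derivation br (D : {linear V -> V}) : Prop :=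
  forall u v, br (D u) v + br u (D v) = D (br u v).

Definition orthonormal_basis mu e : Prop :=
  [/\ basis_of fullv [tuple e i | i < d.+1],
      forall i j, i != j -> mu (e i) (e j) = 0,
      forall i, i != ord_max -> mu (e i) (e i) = 1
    & mu (e ord_max) (e ord_max) = -1].

(* By Sylvester's law of inertia, signature (d, 1) means that there is an
   orthonormal basis with d vectors of square 1 and one of square -1. *)
Definition lorentzian mu : Prop :=
  [/\ bilinear_for *%R *%R mu, forall x y, mu x y = mu y x,
      forall x, (forall y, mu x y = 0) -> x = 0
    & exists e, orthonormal_basis mu e].

Definition gram mu : 'M[R]_d.+1 :=
  \matrix_(i, j) mu (delta_mx 0 i) (delta_mx 0 j).

(* The Koszul formula, solved for nabla_u v in the standard coordinates; see
   levi_civitaP for its characterization by the formula itself. *)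
Definition levi_civita br mu (u v : V) : V :=
  2^-1 *: ((\row_j (mu (br u v) (delta_mx 0 j) + mu (br (delta_mx 0 j) u) v
                    + mu (br (delta_mx 0 j) v) u)) *m invmx (gram mu)).

Definition koszul br mu (nabla : V -> V -> V) : Prop :=
  forall u v w,
    2 * mu (nabla u v) w = mu (br u v) w + mu (br w u) v + mu (br w v) u.

Definition curvature br mu (u v w : V) : V :=
  let nabla := levi_civita br mu in
  nabla (br u v) w - nabla u (nabla v w) + nabla v (nabla u w).

(* The Ricci operator, computed in the orthonormal basis e; by ricci_indep the
   result does not depend on e. *)
Definition ricci br mu e (u : V) : V :=
  \sum_k mu (e k) (e k) *: curvature br mu (e k) u (e k).

Definition algebraic_ricci_soliton br mu : Prop :=
  lorentzian mu /\
  exists e, orthonormal_basis mu e /\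
  exists (eta : R) (D : {linear V -> V}),
    derivation br D /\ forall u, ricci br mu e u = eta *: u + D u.

Definition represented_by e (f : V -> V) (M : 'M[R]_d.+1) : Prop :=
  linear f /\ forall j, f (e j) = \sum_i M i j *: e i.

End LorentzianLieAlgebras.

Section LeviCivitaTheory.
Variables (R : realType) (d : nat).
Local Notation V := 'rV[R]_d.+1.
Variables (br : {bilinear V -> V -> V}) (mu : {biscalar V}).
Hypothesis mu_nondeg : forall x, (forall y, mu x y = 0) -> x = 0.

Lemma gramE (u v : V) : mu u v = (u *m gram mu *m v^T) 0 0.
Proof.
rewrite [in LHS](row_sum_delta u) [in LHS](row_sum_delta v).
rewrite linear_sumr mxE; apply: eq_bigr => j _; rewrite linearZr_LR /=.
rewrite linear_sumlz mxE mulr_suml mulr_sumr.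
apply: eq_bigr => i _; rewrite linearZl_LR /= !mxE.
by rewrite mulrC -!mulrA; congr (_ * _); rewrite mulrC.
Qed.

Lemma gram_unit : gram mu \in unitmx.
Proof.
rewrite -row_free_unit -kermx_eq0; apply/eqP/row_matrixP => i.
rewrite row0; apply: mu_nondeg => y; rewrite gramE -row_mul mulmx_ker.
by rewrite row0 mul0mx mxE.
Qed.

Lemma levi_civita_koszul : koszul br mu (levi_civita br mu).
Proof.
move=> u v w; rewrite gramE /levi_civita -!scalemxAl mulmxKV ?gram_unit //.
rewrite [LHS]/= mxE mulrA divff ?pnatr_eq0 // mul1r mxE.
rewrite [in RHS](row_sum_delta w).
rewrite linear_sumr !linear_sumlz -!big_split /=.
apply: eq_bigr => j _; rewrite !mxE.
by rewrite !(linearZl_LR, linearZr_LR) /= -!mulrDr mulrC.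
Qed.

Lemma levi_civitaP nabla :
  koszul br mu nabla <-> forall u v, nabla u v = levi_civita br mu u v.
Proof.
split=> [Kn u v|E u v w]; last by rewrite E levi_civita_koszul.
apply/eqP; rewrite -subr_eq0; apply/eqP/mu_nondeg => w.
rewrite linearBl; apply: (@mulfI _ 2); first by rewrite pnatr_eq0.
by rewrite mulrBr Kn levi_civita_koszul subrr mulr0.
Qed.

Lemma levi_civita_bilinear : bilinear_for *:%R *:%R (levi_civita br mu).
Proof.
have inj2 : injective ( *%R (2 : R)) by apply: mulfI; rewrite pnatr_eq0.
have ext x y : (forall w, 2 * mu x w = 2 * mu y w) -> x = y.
  move=> E; apply/eqP; rewrite -subr_eq0; apply/eqP/mu_nondeg => w.
  by rewrite linearBl (inj2 _ _ (E w)) subrr.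
split=> [v|u] a x y; apply: ext => w;
  rewrite linearPl mulrDr mulrCA !levi_civita_koszul
    !(linearPl, linearPr) /=; ring.
Qed.

Lemma orthonormal_sum (B : {bilinear V -> V -> V}) e :
    orthonormal_basis mu e ->
  \sum_k mu (e k) (e k) *: B (e k) (e k) =
  \sum_i \sum_j invmx (gram mu) i j *: B (delta_mx 0 i) (delta_mx 0 j).
Proof.
case=> _ e_orth e1 eN1.
pose E := \matrix_k e k; pose S : 'M[R]_d.+1 := \matrix_(k, l) mu (e k) (e l).
have SE : S = diag_mx (\row_k mu (e k) (e k)).
  apply/matrixP => k l; rewrite !mxE.
  by have [->|/e_orth->] := eqVneq k l; rewrite ?mulr1n ?mulr0n.
have EGE : E *m gram mu *m E^T = S.
  apply/matrixP => k l; rewrite [RHS]mxE gramE !mxE.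
  apply: eq_bigr => j _; rewrite !mxE; congr (_ * _).
  by apply: eq_bigr => i _; rewrite !mxE.
have SS : S *m S = 1%:M.
  rewrite SE mulmx_diag -diag_const_mx; congr diag_mx.
  apply/rowP => k; rewrite !mxE.
  have [->|/e1->] := eqVneq k ord_max; last by rewrite mulr1.
  by rewrite eN1 mulrNN mulr1.
have iG : invmx (gram mu) = E^T *m S *m E.
  have H : E *m (gram mu *m E^T *m S) = 1%:M by rewrite !mulmxA EGE SS.
  have := mulmx1C H; rewrite -!mulmxA => H1.
  by rewrite -[LHS]mulmx1 -H1 mulKmx ?gram_unit.
transitivity (\sum_k \sum_i \sum_j
    (mu (e k) (e k) * (E k i * E k j)) *: B (delta_mx 0 i) (delta_mx 0 j)).
  apply: eq_bigr => k _; rewrite {3 4}(row_sum_delta (e k)) linear_sumlz.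
  rewrite scaler_sumr; apply: eq_bigr => i _.
  rewrite linear_sumr scaler_sumr; apply: eq_bigr => j _.
  by rewrite linearZl_LR linearZr_LR /= !scalerA !mxE mulrA.
rewrite exchange_big; apply: eq_bigr => i _ /=.
rewrite exchange_big; apply: eq_bigr => j _ /=.
rewrite -scaler_suml iG SE; congr (_ *: _).
rewrite mul_mx_diag mxE; apply: eq_bigr => k _; rewrite !mxE.
by rewrite mulrA; congr (_ * _); rewrite mulrC.
Qed.

Lemma ricci_indep e e' : orthonormal_basis mu e -> orthonormal_basis mu e' ->
  forall u, ricci br mu e u = ricci br mu e' u.
Proof.
move=> he he' u; pose L := levi_civita br mu.
have [Ll Lr] : bilinear_for *:%R *:%R L := levi_civita_bilinear.
have bil : bilinear_for *:%R *:%R (fun x y => curvature br mu x u y).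
  have LDl a x y z : L (a *: x + y) z = a *: L x z + L y z := Ll z a x y.
  have LDr a x y z : L z (a *: x + y) = a *: L z x + L z y := Lr z a x y.
  have lin a (p q r p' q' r' : V) : a *: p + p' - (a *: q + q') + (a *: r + r')
      = a *: (p - q + r) + (p' - q' + r').
    by apply/rowP => j; rewrite !mxE; ring.
  split=> [y a x x'|x a y y']; rewrite /curvature -/L.
    by rewrite linearPl !(LDl, LDr) lin.
  by rewrite !LDr lin.
pose B := HB.pack_for {bilinear V -> V -> V} (fun x y => curvature br mu x u y)
  (bilinear_isBilinear.Build _ _ _ _ _ _ _ bil).
by have := orthonormal_sum B he; rewrite -(orthonormal_sum B he').
Qed.
End LeviCivitaTheory.

Section Heisenberg.
Variables (R : realType) (n : nat) (sigma : nat -> R) (lambda : R).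

Local Notation V := 'rV[R]_(n.*2.+1).

(* The standard basis of V is f_1, g_1, ..., f_n, g_n, z in this order: i : 'I_n
   stands for the mathematical index i + 1, so f_(i+1) and g_(i+1) sit at the
   0-based positions 2i and 2i + 1, and z at position 2n. *)
Definition heis_f (i : 'I_n) : V := delta_mx 0 (inord i.*2).
Definition heis_g (i : 'I_n) : V := delta_mx 0 (inord i.*2.+1).
Definition heis_z : V := delta_mx 0 ord_max.

Definition heis_bracket (u v : V) : V :=
  (\sum_(i < n) (u 0 (inord i.*2) * v 0 (inord i.*2.+1)
                 - u 0 (inord i.*2.+1) * v 0 (inord i.*2))) *: heis_z.

(* sigma is indexed from 1; only sigma 1, ..., sigma (n - 1) are used. The
   0-based position j < 2n belongs to the pair f_k, g_k with k = j./2 + 1. *)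
Definition heis_weight (j : 'I_n.*2.+1) : R :=
  if j == ord_max then - lambda
  else if (j./2.+1 < n)%N then sigma j./2.+1 else 1.

Definition heis_metric (u v : V) : R :=
  \sum_j heis_weight j * u 0 j * v 0 j.

Definition heis_basis (j : 'I_n.*2.+1) : V :=
  if j == ord_max then (Num.sqrt lambda)^-1 *: delta_mx 0 j
  else if (j./2.+1 < n)%N then (Num.sqrt (sigma j./2.+1))^-1 *: delta_mx 0 j
  else delta_mx 0 j.

(* diag{a, ..., a, b} *)
Definition diag_last (a b : R) : 'M[R]_(n.*2.+1) :=
  diag_mx (\row_j if j == ord_max then b else a).

Lemma heis_bracket_fg (i j : 'I_n) :
  [/\ heis_bracket (heis_f i) (heis_g j) = (i == j)%:R *: heis_z,
      heis_bracket (heis_f i) (heis_f j) = 0,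
      heis_bracket (heis_g i) (heis_g j) = 0,
      heis_bracket (heis_f i) heis_z = 0
    & heis_bracket (heis_g i) heis_z = 0].
Proof.
have lt_f (k : 'I_n) : (k.*2 < n.*2.+1)%N by rewrite ltnS leq_double ltnW.
have lt_g (k : 'I_n) : (k.*2.+1 < n.*2.+1)%N by rewrite ltnS ltn_double.
have ff (k l : 'I_n) : (inord k.*2 == inord l.*2 :> 'I_n.*2.+1) = (k == l).
  by rewrite -(inj_eq val_inj) /= !inordK // (inj_eq double_inj).
have gg (k l : 'I_n) : (inord k.*2.+1 == inord l.*2.+1 :> 'I_n.*2.+1) = (k == l).
  by rewrite -(inj_eq val_inj) /= !inordK // eqSS (inj_eq double_inj).
have fg (k l : 'I_n) : (inord k.*2 == inord l.*2.+1 :> 'I_n.*2.+1) = false.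
  rewrite -(inj_eq val_inj) /= !inordK //; apply/eqP => /(congr1 odd).
  by rewrite /= !odd_double.
have gf (k l : 'I_n) : (inord k.*2.+1 == inord l.*2 :> 'I_n.*2.+1) = false.
  by rewrite eq_sym fg.
have fz (k : 'I_n) : (inord k.*2 == ord_max :> 'I_n.*2.+1) = false.
  rewrite -(inj_eq val_inj) /= !inordK // (inj_eq double_inj).
  by apply/negbTE; rewrite neq_ltn ltn_ord.
have gz (k : 'I_n) : (inord k.*2.+1 == ord_max :> 'I_n.*2.+1) = false.
  rewrite -(inj_eq val_inj) /= !inordK //; apply/eqP => /(congr1 odd).
  by rewrite /= !odd_double.
split; rewrite /heis_bracket; last first.
- by rewrite big1 ?scale0r // => k _;
  rewrite !mxE !(ff, gg, fg, gf, fz, gz) !mulr0 subr0.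
- by rewrite big1 ?scale0r // => k _;
  rewrite !mxE !(ff, gg, fg, gf, fz, gz) !mulr0 subr0.
- by rewrite big1 ?scale0r // => k _;
  rewrite !mxE !(ff, gg, fg, gf, fz, gz) !mulr0 !mul0r subr0.
- by rewrite big1 ?scale0r // => k _;
  rewrite !mxE !(ff, gg, fg, gf, fz, gz) !mulr0 !mul0r subr0.
congr (_ *: _); rewrite (bigD1 i) //= big1 => [|k ki].
  by rewrite !mxE !(ff, gg, fg, gf) !eqxx /= mul1r mul0r subr0 addr0.
by rewrite !mxE !(ff, gg, fg, gf) (negbTE ki) !mul0r subrr.
Qed.

Lemma heis_lie_bracket : lie_bracket heis_bracket.
Proof.
have z0 (w : V) c : heis_bracket w (c *: heis_z) = 0.
  rewrite /heis_bracket big1 ?scale0r // => k _; rewrite !mxE.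
  have -> : (inord k.*2 == ord_max :> 'I_n.*2.+1) = false.
    rewrite -(inj_eq val_inj) /= inordK ?ltnS ?leq_double ?(ltnW (ltn_ord k)) //.
    by rewrite (inj_eq double_inj); apply/negbTE; rewrite neq_ltn ltn_ord.
  have -> : (inord k.*2.+1 == ord_max :> 'I_n.*2.+1) = false.
    rewrite -(inj_eq val_inj) /= inordK ?ltnS ?ltn_double //.
    by apply/eqP => /(congr1 odd); rewrite /= !odd_double.
  by rewrite !mulr0 subrr.
split; last by move=> x y z; rewrite !z0 !addr0.
- split=> [v a x y|u a x y]; rewrite /heis_bracket /= scalerA -scalerDl;
  by congr (_ *: _); rewrite mulr_sumr -big_split; apply: eq_bigr => i _;
     rewrite !mxE /=; ring.
- move=> x; rewrite /heis_bracket big1 ?scale0r // => i _.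
  by rewrite mulrC subrr.
Qed.

Hypothesis lambda_gt0 : 0 < lambda.
Hypothesis sigma_ge1 : forall k, (1 <= k < n)%N -> 1 <= sigma k.

Let metric_delta i j : heis_metric (delta_mx 0 i) (delta_mx 0 j) =
  heis_weight i *+ (i == j).
Proof.
rewrite /heis_metric (bigD1 i) //= big1 => [|k ki].
  by rewrite !mxE !eqxx mulr1 addr0 mulr_natr.
by rewrite !mxE (negbTE ki) mulr0 mul0r.
Qed.

Let bilin : bilinear_for *%R *%R heis_metric.
Proof.
split=> [v a x y|u a x y]; rewrite /heis_metric /= mulr_sumr -big_split;
  by apply: eq_bigr => i _; rewrite !mxE /=; ring.
Qed.

Lemma heis_basis_orthonormal : orthonormal_basis heis_metric heis_basis.
Proof.
pose c (j : 'I_n.*2.+1) : R := if j == ord_max then (Num.sqrt lambda)^-1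
  else if (j./2.+1 < n)%N then (Num.sqrt (sigma j./2.+1))^-1 else 1.
have bE j : heis_basis j = c j *: delta_mx 0 j.
  by rewrite /heis_basis /c; case: ifP => //; case: ifP => // *; rewrite scale1r.
have s_gt0 k : (k.+1 < n)%N -> 0 < sigma k.+1.
  by move=> kn; apply: lt_le_trans (sigma_ge1 _).
have mE i j : heis_metric (heis_basis i) (heis_basis j) =
    c i * c j * (heis_weight i *+ (i == j)).
  rewrite !bE -metric_delta /heis_metric mulr_sumr.
  by apply: eq_bigr => k _; rewrite !mxE; ring.
have sq x : 0 < x -> (Num.sqrt x)^-1 * (Num.sqrt x)^-1 * x = 1 :> R.
  move=> x0; rewrite -invfM -expr2 sqr_sqrtr ?ltW // mulVf //.
  by rewrite gt_eqF.
split.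
- rewrite basisEfree; apply/and3P; split; last 1 first.
    by rewrite size_tuple dimvf [dim _]mul1n.
  all: rewrite ?subvf //.
  pose X := [tuple heis_basis j | j < n.*2.+1].
  have/freeP : (forall k, \sum_(i < n.*2.+1) k i *: X`_i = 0 -> forall i, k i = 0); last by [].
  have XE (i : 'I_n.*2.+1) : X`_i = heis_basis i by rewrite -tnth_nth tnth_mktuple.
  move=> k k0 i.
  move/rowP/(_ i): k0; rewrite summxE (bigD1 i) //= big1 => [|j ji].
    rewrite addr0 XE bE !mxE !eqxx mulr1 => /eqP.
    rewrite mulf_eq0 => /orP[/eqP //|]; rewrite /c.
    case: ifP => [_|_]; first by rewrite invr_eq0 sqrtr_eq0 leNgt lambda_gt0.
    case: ifP => [/s_gt0 h|_]; last by rewrite oner_eq0.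
    by rewrite invr_eq0 sqrtr_eq0 leNgt h.
  by rewrite XE bE !mxE eq_sym (negbTE ji) !mulr0.
- by move=> i j ij; rewrite mE (negbTE ij) mulr0.
- move=> i im; rewrite mE eqxx /c /heis_weight (negbTE im) mulr1n.
  by case: ifP => [/s_gt0 /sq //|_]; rewrite !mulr1.
- by rewrite mE /c /heis_weight !eqxx mulr1n mulrN sq.
Qed.

Lemma heis_metric_lorentzian : lorentzian heis_metric.
Proof.
split; [exact: bilin | | |by exists heis_basis; apply: heis_basis_orthonormal].
- by move=> x y; apply: eq_bigr => i _; rewrite mulrAC.
- move=> x x0; apply/rowP => i; rewrite mxE.
  have := x0 (delta_mx 0 i); rewrite /heis_metric (bigD1 i) //= big1 => [|k ki].
    rewrite addr0 !mxE !eqxx mulr1 => /eqP; rewrite mulf_eq0 => /orP[|/eqP //].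
    rewrite /heis_weight; case: ifP => [_|_]; first by rewrite oppr_eq0 gt_eqF.
    case: ifP => [h|_]; last by rewrite oner_eq0.
    by rewrite gt_eqF // (lt_le_trans ltr01) // sigma_ge1.
  by rewrite !mxE (negbTE ki) andbF mulr0.
Qed.

End Heisenberg.

(* Main.v *)
Require Import Defs.
From HB Require Import structures.
From mathcomp Require Import all_boot all_order all_algebra.
From mathcomp Require Import sesquilinear reals.
From mathcomp Require Import ring lra.

Import Order.TTheory GRing.Theory Num.Theory.
Local Open Scope ring_scope.

(** Every bracket of the Heisenberg algebra is a multiple of the centre [z], so
the bracket is [[x, y] = <J x, y> z] for a skew operator [J] that kills [z].
For any nondegenerate metric and any bracket of this shape the Koszul formula
is solved explicitly by
  [nabla_u v = (<J u, v> z - <z, v> J u - <z, u> J v) / 2],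
and tracing the resulting curvature over an orthonormal basis leaves only
  [Ric u = <z, z> / 2 J^2 u + tr / 4 <z, u> z],
where [tr] is the sum of the [<v, v> <J v, J v>] over the basis ([ricciE]).

For the diagonal metric, writing [h_i] for the common square length of [f_i]
and [g_i], one has [J f_i = g_i / h_i], [J g_i = - f_i / h_i] and
[<z, z> = - lambda]. Hence [Ric] is diagonal, with eigenvalue
[lambda / (2 h_i^2)] on the plane of [f_i] and [g_i], and
[- lambda / 2 * sum_i h_i^-2] on [z] ([heis_ricci]).

A diagonal operator is a derivation exactly when its eigenvalues satisfy
[d(f_i) + d(g_i) = d(z)] for all [i], because of [[f_i, g_i] = z]
([derivation_pair], [diag_derivation]). If [Ric - eta Id] is a derivation, then
[lambda / h_i^2] is therefore independent of [i]; since [h_n = 1] and [h_i > 0],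
every [h_i] equals 1. Conversely, when all [h_i] are 1, subtracting
[eta = (n + 2) lambda / 2] from the two eigenvalues [lambda / 2] and
[- n lambda / 2] of [Ric] leaves [d] and [2 d] with
[d = - (n + 1) lambda / 2], which is a derivation. *)

(** * Orthonormal frames and diagonal matrices *)

Section Frames.
Context {R : realType} {d : nat}.
Local Notation V := 'rV[R]_d.+1.
Context {mu : {biscalar V}} {e : 'I_d.+1 -> V}.
Hypothesis e_onb : orthonormal_basis mu e.

Lemma orthonormal_expansion x : \sum_k (mu (e k) (e k) * mu x (e k)) *: e k = x.
Proof.
case: e_onb => e_basis e_orth e1 eN1.
have sq k : mu (e k) (e k) * mu (e k) (e k) = 1.
  by have [->|/e1->] := eqVneq k ord_max; rewrite ?eN1 ?mulrNN mulr1.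
have /coord_span xE : x \in <<[tuple e i | i < d.+1]>>%VS.
  by rewrite (span_basis e_basis) memvf.
pose c k := coord [tuple e i | i < d.+1] k x.
have {}xE : x = \sum_k c k *: e k.
  by rewrite {1}xE; apply: eq_bigr => k _; rewrite -tnth_nth tnth_mktuple.
rewrite [RHS]xE; apply: eq_bigr => k _; congr (_ *: _).
rewrite {1}xE linear_sumlz (bigD1 k) //= big1 => [|l lk].
  by rewrite addr0 linearZl_LR /= mulrCA sq mulr1.
by rewrite linearZl_LR /= e_orth // mulr0.
Qed.

End Frames.

Lemma delta_mul_diag {R : realType} {m} (d : 'rV[R]_m) j :
  (delta_mx 0 j : 'rV[R]_m) *m diag_mx d = d 0 j *: delta_mx 0 j.
Proof.
apply/rowP => k; rewrite mul_mx_diag !mxE.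
by have [->|_] := eqVneq k j; rewrite ?mul1r ?mulr1 // !(mul0r, mulr0).
Qed.

(** * Ricci operator of a metric Lie algebra with brackets on a line *)

Section OneDimensionalDerivedAlgebra.
Context {R : realType} {d : nat}.
Local Notation V := 'rV[R]_d.+1.
Context {br : {bilinear V -> V -> V}} {mu : {biscalar V}}.
Context {J : {linear V -> V}} {z : V}.
Hypothesis mu_sym : forall x y, mu x y = mu y x.
Hypothesis mu_nondeg : forall x, (forall y, mu x y = 0) -> x = 0.
Hypothesis J_skew : forall x y, mu (J x) y = - mu x (J y).
Hypothesis Jz : J z = 0.
Hypothesis brE : forall x y, br x y = mu (J x) y *: z.

(** By skewness, [<[w, x], y> = <J w, x> <z, y> = - <w, J x> <z, y>]: the right-hand
side of the Koszul formula is the product of [w] with an explicit vector. *)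
Lemma levi_civitaE u v : levi_civita br mu u v =
  2^-1 *: (mu (J u) v *: z - mu z v *: J u - mu z u *: J v).
Proof.
apply: esym; move: u v.
apply/(levi_civitaP br mu_nondeg
  (fun u v => 2^-1 *: (mu (J u) v *: z - mu z v *: J u - mu z u *: J v))) => u v w.
rewrite !brE !(linearZl_LR, linearBl) /=.
rewrite mulrA divff ?pnatr_eq0 // mul1r !(J_skew w) !(mu_sym w); ring.
Qed.

(** Since [z] is orthogonal to the image of [J] and [J z = 0], every second
covariant derivative stays in the span of [z], [J e], [J^2 e] and [J^2 u]; the
diagonal terms [<J e, e>] vanish by skewness. *)
Lemma curvatureE u e : curvature br mu e u e =
  - (3 / 4 * mu z z * mu (J e) u) *: J e - (4^-1 * mu z e ^+ 2) *: J (J u)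
  + (4^-1 * mu (J e) (J e) * mu z u) *: z
  - (4^-1 * mu z e * mu (J e) (J u)) *: z + (4^-1 * mu z e * mu z u) *: J (J e).
Proof.
have zJ x : mu z (J x) = 0 by rewrite mu_sym J_skew Jz linear0r oppr0.
have JJ : mu (J u) (J e) = mu (J e) (J u) by exact: mu_sym.
have Jue : mu (J u) e = - mu (J e) u by rewrite J_skew mu_sym.
have Jee : mu (J e) e = 0.
  have : mu (J e) e = - mu (J e) e by rewrite {1}J_skew mu_sym.
  by move: (mu (J e) e) => t; lra.
have Jxz x : mu (J x) z = 0 by rewrite mu_sym zJ.
have JZ a x : J (a *: x) = a *: J x by exact: linearZ.
have JB x y : J (x - y) = J x - J y by exact: raddfB.
have JL a b c x y :
    J (2^-1 *: (a *: z - b *: x - c *: y)) = - 2^-1 *: (b *: J x + c *: J y).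
  by rewrite !(JZ, JB) Jz scaler0 sub0r -opprD scalerN scaleNr.
have zL a b c x y :
    mu z (2^-1 *: (a *: z - b *: J x - c *: J y)) = 2^-1 * (a * mu z z).
  by rewrite linearZr_LR /= !linearBr !linearZr_LR /= !zJ !mulr0 !subr0.
have muL w a b c x y : mu (J w) (2^-1 *: (a *: z - b *: x - c *: y)) =
    - 2^-1 * (b * mu (J w) x + c * mu (J w) y).
  rewrite linearZr_LR /= !linearBr !linearZr_LR /= Jxz mulr0 sub0r -opprD.
  by rewrite mulrN mulNr.
have zZ a : mu z (a *: z) = a * mu z z by rewrite linearZr_LR.
rewrite /curvature !levi_civitaE brE !(JL, zL, muL, JZ, Jz, zZ, scaler0) linear0l.
rewrite !(JJ, Jue, Jee).
by apply/rowP => j; rewrite !mxE; field.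
Qed.

(** In the sum over the basis, the terms of [curvatureE] linear in [<z, e>]
assemble the expansion of [z] inside [J], and so disappear. The first term
contributes [3/4 <z, z> J^2 u] through the expansion of [J u], the second one
[-1/4 <z, z> J^2 u] through the expansion of [z]. *)
Lemma ricciE e u : orthonormal_basis mu e -> ricci br mu e u =
  (mu z z / 2) *: J (J u)
  + (4^-1 * (\sum_k mu (e k) (e k) * mu (J (e k)) (J (e k))) * mu z u) *: z.
Proof.
move=> e_onb; rewrite /ricci.
have JZ a x : J (a *: x) = a *: J x by exact: linearZ.
have Jsum (F : 'I_d.+1 -> V) : J (\sum_k F k) = \sum_k J (F k).
  exact: linear_sum.
pose eps k := mu (e k) (e k).
have expand x : \sum_k (eps k * mu x (e k)) *: e k = x.
  exact: orthonormal_expansion.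
have expandJ : \sum_k (eps k * mu (J (e k)) u) *: J (e k) = - J (J u).
  rewrite -(expand (J u)) Jsum -sumrN; apply: eq_bigr => k _.
  by rewrite JZ J_skew mu_sym mulrN scaleNr.
have Pz : \sum_k eps k * mu z (e k) ^+ 2 = mu z z.
  rewrite -[X in _ = mu _ X](expand z) linear_sumr; apply: eq_bigr => k _.
  by rewrite linearZr_LR /= expr2 mulrA.
have Jexp : \sum_k (eps k * mu z (e k)) *: J (e k) = 0.
  rewrite -[RHS]Jz -[X in _ = J X](expand z) Jsum; apply: eq_bigr => k _.
  by rewrite JZ.
(* The traced curvature, with each sum gathered as one of the three above. *)
have -> : \sum_k mu (e k) (e k) *: curvature br mu (e k) u (e k) =
  - (3 / 4 * mu z z) *: (\sum_k (eps k * mu (J (e k)) u) *: J (e k))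
  - (4^-1 * \sum_k eps k * mu z (e k) ^+ 2) *: J (J u)
  + (4^-1 * (\sum_k mu (e k) (e k) * mu (J (e k)) (J (e k))) * mu z u) *: z
  - (4^-1 * mu (\sum_k (eps k * mu z (e k)) *: J (e k)) (J u)) *: z
  + (4^-1 * mu z u) *: J (\sum_k (eps k * mu z (e k)) *: J (e k)).
  rewrite linear_sumlz Jsum !mulr_sumr mulr_suml !scaler_suml !scaler_sumr.
  rewrite -!sumrN -!big_split /=; apply: eq_bigr => k _.
  rewrite curvatureE linearZl_LR JZ -/(eps k) /=.
  by apply/rowP => j; rewrite !mxE; ring.
rewrite expandJ Pz Jexp linear0l linear0.
by apply/rowP => j; rewrite !mxE; field.
Qed.
End OneDimensionalDerivedAlgebra.

(** * Indices of the Heisenberg basis *)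

Section HeisenbergIndices.
Context {n : nat}.

Definition fidx (i : 'I_n) : 'I_n.*2.+1 := inord i.*2.
Definition gidx (i : 'I_n) : 'I_n.*2.+1 := inord i.*2.+1.

Lemma val_fidx i : fidx i = i.*2 :> nat.
Proof. by rewrite inordK // ltnS leq_double ltnW. Qed.

Lemma val_gidx i : gidx i = i.*2.+1 :> nat.
Proof. by rewrite inordK // ltnS ltn_double. Qed.

Lemma fidx_neq_max i : (fidx i == ord_max) = false.
Proof.
by rewrite -val_eqE /= val_fidx (inj_eq double_inj) ltn_eqF.
Qed.

Lemma gidx_neq_max i : (gidx i == ord_max) = false.
Proof.
rewrite -val_eqE /= val_gidx; apply/eqP => /(congr1 odd).
by rewrite /= !odd_double.
Qed.

Variant heis_idx_spec : 'I_n.*2.+1 -> Prop :=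
  | HeisIdxF i : heis_idx_spec (fidx i)
  | HeisIdxG i : heis_idx_spec (gidx i)
  | HeisIdxZ : heis_idx_spec ord_max.

Lemma heis_idxP j : heis_idx_spec j.
Proof.
have [-> | jn] := eqVneq j ord_max; first exact: HeisIdxZ.
have lt_jn : (j < n.*2)%N by rewrite ltn_neqAle -ltnS ltn_ord andbT.
have lt_j2n : (j./2 < n)%N by rewrite ltn_half_double.
have := odd_double_half j; case: (odd j) => /= jE.
  suff -> : j = gidx (Ordinal lt_j2n) by exact: HeisIdxG.
  by apply: val_inj; rewrite /= val_gidx.
suff -> : j = fidx (Ordinal lt_j2n) by exact: HeisIdxF.
by apply: val_inj; rewrite /= val_fidx.
Qed.

Lemma heis_sum {V : nmodType} (F : 'I_n.*2.+1 -> V) :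
  \sum_j F j = \sum_(i < n) (F (fidx i) + F (gidx i)) + F ord_max.
Proof.
rewrite big_ord_recr /=; congr (_ + _).
have sum2 (H : nat -> V) m :
    \sum_(j < m.*2) H j = \sum_(i < m) (H i.*2 + H i.*2.+1).
  elim: m => [|m IHm]; first by rewrite !big_ord0.
  by rewrite doubleS !big_ord_recr /= IHm addrA.
rewrite -(sum2 (fun k => F (inord k))); apply: eq_bigr => j _.
by congr F; apply: val_inj; rewrite /= inordK // ltnS ltnW.
Qed.

End HeisenbergIndices.

(** * Ricci operator of the diagonal Lorentzian metrics *)

Section HeisenbergRicci.
Context {R : realType} {n : nat} {sigma : nat -> R} {lambda : R}.
Local Notation V := 'rV[R]_n.*2.+1.
Local Notation mu := (@heis_metric R n sigma lambda).
Local Notation br := (@heis_bracket R n).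
Local Notation B := (@heis_basis R n sigma lambda).
Local Notation z := (@heis_z R n).

(** The last pair has length 1 and takes no [sigma]: the default value encodes
[sigma_n = 1]. *)
Definition pair_weight (i : 'I_n) : R :=
  if (i.+1 < n)%N then sigma i.+1 else 1.
Local Notation h := pair_weight.

Lemma weight_f i : heis_weight sigma lambda (fidx i) = h i.
Proof. by rewrite /heis_weight fidx_neq_max val_fidx doubleK. Qed.

Lemma weight_g i : heis_weight sigma lambda (gidx i) = h i.
Proof.
by rewrite /heis_weight gidx_neq_max val_gidx -[_./2]/(uphalf i.*2) uphalf_double.
Qed.

Lemma basis_f i : B (fidx i) = (Num.sqrt (h i))^-1 *: heis_f R i.
Proof.
rewrite /heis_basis fidx_neq_max val_fidx doubleK /h.
by case: ifP => _; rewrite // sqrtr1 invr1 scale1r.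
Qed.

Lemma basis_g i : B (gidx i) = (Num.sqrt (h i))^-1 *: heis_g R i.
Proof.
rewrite /heis_basis gidx_neq_max val_gidx -[_./2]/(uphalf i.*2) uphalf_double /h.
by case: ifP => _; rewrite // sqrtr1 invr1 scale1r.
Qed.

Lemma basis_z : B ord_max = (Num.sqrt lambda)^-1 *: z.
Proof. by rewrite /heis_basis eqxx. Qed.

Lemma metricE u v : mu u v =
  \sum_i (h i * (u 0 (fidx i) * v 0 (fidx i) + u 0 (gidx i) * v 0 (gidx i)))
  - lambda * (u 0 ord_max * v 0 ord_max).
Proof.
rewrite /heis_metric heis_sum; congr (_ + _).
  by apply: eq_bigr => i _; rewrite weight_f weight_g; ring.
by rewrite /heis_weight eqxx; ring.
Qed.

Lemma metric_delta j : mu (delta_mx 0 j) (delta_mx 0 j) = heis_weight sigma lambda j.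
Proof.
rewrite /heis_metric (bigD1 j) //= big1 => [|k kj].
  by rewrite !mxE !eqxx !mulr1 addr0.
by rewrite !mxE (negbTE kj) mulr0.
Qed.

Fact bracket_bilinear : bilinear_for *:%R *:%R br.
Proof. by case: (heis_lie_bracket R n). Qed.
HB.instance Definition _ :=
  bilinear_isBilinear.Build R V V V _ _ br bracket_bilinear.

Fact metric_bilinear : bilinear_for *%R *%R mu.
Proof.
split=> [v a x y|u a x y]; rewrite /heis_metric /= mulr_sumr -big_split;
  by apply: eq_bigr => i _; rewrite !mxE /=; ring.
Qed.
HB.instance Definition _ :=
  bilinear_isBilinear.Build R V V R _ _ mu metric_bilinear.

(** [J f_i = g_i / h_i], [J g_i = - f_i / h_i] and [J z = 0]: the operator that
represents the bracket through the metric, see [bracketE]. *)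
Definition heis_J (u : V) : V :=
  \row_j if j == ord_max then 0
         else if odd j then u 0 (inord j.-1) / heis_weight sigma lambda j
         else - u 0 (inord j.+1) / heis_weight sigma lambda j.
Local Notation J := heis_J.

Fact J_linear : linear J.
Proof.
move=> a u v; apply/rowP => j; rewrite !mxE.
by case: ifP => _; [|case: ifP => _]; ring.
Qed.
HB.instance Definition _ := GRing.isLinear.Build R V V *:%R J J_linear.

Lemma J_f u i : J u 0 (fidx i) = - u 0 (gidx i) / h i.
Proof. by rewrite mxE fidx_neq_max weight_f val_fidx odd_double. Qed.

Lemma J_g u i : J u 0 (gidx i) = u 0 (fidx i) / h i.
Proof. by rewrite mxE gidx_neq_max weight_g val_gidx /= odd_double. Qed.

Lemma J_max u : J u 0 ord_max = 0.
Proof. by rewrite mxE eqxx. Qed.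

Hypothesis lambda_gt0 : 0 < lambda.
Hypothesis sigma_ge1 : forall k, (1 <= k < n)%N -> 1 <= sigma k.

Lemma h_gt0 i : 0 < h i.
Proof.
rewrite /h; case: ifP => // lt_in.
by rewrite (lt_le_trans ltr01) // sigma_ge1.
Qed.

Lemma J_z : J z = 0.
Proof.
apply/rowP => j; rewrite [RHS]mxE; case: (heis_idxP j) => [i|i|];
  by rewrite ?J_f ?J_g ?J_max // mxE ?gidx_neq_max ?fidx_neq_max ?oppr0 mul0r.
Qed.

Lemma bracketE u v : br u v = mu (J u) v *: z.
Proof.
rewrite metricE J_max mul0r mulr0 subr0; congr (_ *: _).
apply: eq_bigr => i _; rewrite J_f J_g -/(fidx i) -/(gidx i).
by field; rewrite gt_eqF // h_gt0.
Qed.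

Lemma J_skew u v : mu (J u) v = - mu u (J v).
Proof.
rewrite !metricE !J_max mul0r !mulr0 !subr0 -sumrN; apply: eq_bigr => i _.
by rewrite !J_f !J_g; ring.
Qed.

Lemma J_sqr u : J (J u) =
  - (u *m diag_mx (\row_j if j == ord_max then 0
                          else (heis_weight sigma lambda j ^+ 2)^-1)).
Proof.
apply/rowP => j; rewrite [RHS]mxE mul_mx_diag [X in - X]mxE [X in _ * X]mxE.
case: (heis_idxP j) => [i|i|].
- by rewrite J_f J_g fidx_neq_max weight_f; field; rewrite gt_eqF // h_gt0.
- by rewrite J_g J_f gidx_neq_max weight_g; field; rewrite gt_eqF // h_gt0.
- by rewrite J_max eqxx mulr0 oppr0.
Qed.

(** A unit vector along [f_i] or [g_i] has image of square length [h_i^-2]; the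
timelike direction [z] is killed by [J], so no sign enters the trace. *)
Lemma sum_norm_J_basis :
  \sum_k mu (B k) (B k) * mu (J (B k)) (J (B k)) = 2 * \sum_i (h i ^+ 2)^-1.
Proof.
have [_ _ B1 _] := heis_basis_orthonormal lambda_gt0 sigma_ge1.
have norm_J j : mu (J (delta_mx 0 j)) (J (delta_mx 0 j)) =
   if j == ord_max then 0 else (heis_weight sigma lambda j)^-1.
  rewrite J_skew J_sqr linearNr opprK.
  rewrite delta_mul_diag linearZr_LR /= metric_delta mxE.
  case: (heis_idxP j) => [i|i|]; rewrite ?eqxx ?mul0r //.
    by rewrite fidx_neq_max weight_f; field; rewrite gt_eqF // h_gt0.
  by rewrite gidx_neq_max weight_g; field; rewrite gt_eqF // h_gt0.
have sqN i : (Num.sqrt (h i))^-1 * (Num.sqrt (h i))^-1 = (h i)^-1.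
  by rewrite -invfM -expr2 sqr_sqrtr // ltW // h_gt0.
have JZ a x : J (a *: x) = a *: J x by exact: linearZ.
rewrite heis_sum basis_z JZ J_z scaler0 linear0r mulr0 addr0 mulr_sumr.
apply: eq_bigr => i _; rewrite !B1 ?fidx_neq_max ?gidx_neq_max // !mul1r.
rewrite basis_f basis_g !JZ !linearZr_LR !linearZl_LR /= !mulrA !sqN.
rewrite !norm_J fidx_neq_max gidx_neq_max weight_f weight_g.
by rewrite -invfM -expr2; ring.
Qed.

Lemma heis_ricci u : ricci br mu B u =
  u *m diag_mx (\row_j if j == ord_max then - (lambda / 2 * \sum_i (h i ^+ 2)^-1)
                       else lambda / 2 / heis_weight sigma lambda j ^+ 2).
Proof.
have B_onb := heis_basis_orthonormal lambda_gt0 sigma_ge1.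
have [_ mu_sym mu_nondeg _] := heis_metric_lorentzian lambda_gt0 sigma_ge1.
rewrite (ricciE mu_sym mu_nondeg J_skew J_z bracketE _ _ B_onb) /=.
rewrite sum_norm_J_basis J_sqr.
have mu_z v : mu z v = - lambda * v 0 ord_max.
  rewrite metricE big1 => [|i _]; first by rewrite mxE !eqxx /=; ring.
  by rewrite !mxE fidx_neq_max gidx_neq_max !mul0r addr0 mulr0.
rewrite !mu_z !mul_mx_diag; apply/rowP => j; rewrite !mxE !eqxx /=.
have [->|_] := eqVneq j ord_max; first by rewrite mulr1n; field.
by set c := (heis_weight _ _ _ ^+ 2)^-1; rewrite mulr0; field.
Qed.

End HeisenbergRicci.
Arguments pair_weight {R n} sigma i.

(** * Diagonal derivations *)

Section DiagonalOperators.
Context {R : realType} {n : nat} {sigma : nat -> R} {lambda : R}.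
Local Notation V := 'rV[R]_n.*2.+1.
Local Notation br := (@heis_bracket R n).
Local Notation B := (@heis_basis R n sigma lambda).

(** The vectors of the orthonormal basis are multiples of the standard ones, so
both bases give a diagonal operator the same matrix. *)
Lemma represented_by_diag (f : V -> V) (d : 'rV[R]_n.*2.+1) :
  (forall u, f u = u *m diag_mx d) -> represented_by B f (diag_mx d).
Proof.
move=> fE; split=> [a u v|j]; first by rewrite !fE mulmxDl scalemxAl.
rewrite (bigD1 j) //= big1 => [|i ij]; last first.
  by rewrite mxE (negbTE ij) mulr0n scale0r.
rewrite addr0 mxE eqxx mulr1n fE.
have [c ->] : exists c, B j = c *: delta_mx 0 j.
  by case: (heis_idxP j) => [i|i|]; rewrite (basis_f, basis_g, basis_z); eexists.
by rewrite -scalemxAl delta_mul_diag !scalerA mulrC.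
Qed.

(** The derivation identity at the pair [f_i], [g_i], read on [z]. *)
Lemma derivation_pair (r : 'rV[R]_n.*2.+1) (D : {linear V -> V}) i :
  derivation br D -> (forall u, D u = u *m diag_mx r) ->
  r 0 (fidx i) + r 0 (gidx i) = r 0 ord_max.
Proof.
move=> D_der DE; have := D_der (heis_f R i) (heis_g R i).
rewrite !DE !delta_mul_diag linearZl_LR linearZr_LR /=.
have [-> _ _ _ _] := heis_bracket_fg R i i; rewrite eqxx scale1r.
by rewrite delta_mul_diag => /rowP/(_ ord_max); rewrite !mxE !eqxx /= !mulr1.
Qed.

Lemma diag_derivation (r : 'rV[R]_n.*2.+1) :
  (forall i, r 0 (fidx i) + r 0 (gidx i) = r 0 ord_max) ->
  derivation br (mulmxr (diag_mx r)).
Proof.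
move=> rE u v /=; rewrite [in RHS]/heis_bracket -scalemxAl delta_mul_diag scalerA.
rewrite /heis_bracket -scalerDl mulr_suml -big_split; congr (_ *: _).
apply: eq_bigr => i _; rewrite -(rE i) !mul_mx_diag !mxE -/(fidx i) -/(gidx i) /=; ring.
Qed.
End DiagonalOperators.

(** * Algebraic Ricci solitons *)

Theorem theorem3p5 (R : realType) (n : nat) (lambda : R) (sigma : nat -> R)
    (n_ge1 : (1 <= n)%N) (lambda_gt0 : 0 < lambda)
    (sigma_noninc : forall i j : nat,
       (1 <= i)%N -> (i <= j)%N -> (j <= n - 1)%N -> sigma j <= sigma i)
    (sigma_ge1 : forall k : nat, (1 <= k <= n - 1)%N -> 1 <= sigma k) :
  let br := @heis_bracket R n in
  let mu := @heis_metric R n sigma lambda in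
  let B := @heis_basis R n sigma lambda in
  let Ric := ricci br mu B in
  let sigma_eq1 := forall k : nat, (1 <= k <= n - 1)%N -> sigma k = 1 in
  (algebraic_ricci_soliton br mu <-> sigma_eq1) /\
  (sigma_eq1 ->
    represented_by B Ric (diag_last n (lambda / 2) (- (n%:R * lambda) / 2)) /\
    exists D : {linear 'rV[R]_(n.*2.+1) -> 'rV[R]_(n.*2.+1)},
      [/\ represented_by B D
            (diag_last n (- ((n%:R + 1) * lambda) / 2) (- ((n%:R + 1) * lambda))),
          derivation br D
        & forall u, Ric u = ((n%:R + 2) * lambda / 2) *: u + D u]).
Proof.
move=> br mu B Ric sigma_eq1.
have le_pred k : (1 <= k <= n - 1)%N = (1 <= k < n)%N.
  by case: (n) n_ge1 => // m _; rewrite subn1 ltnS.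
have sigma_ge1' k : (1 <= k < n)%N -> 1 <= sigma k.
  by rewrite -le_pred; exact: sigma_ge1.
have h_gt0 (i : 'I_n) : 0 < pair_weight sigma i by exact: (h_gt0 sigma_ge1').
have B_onb : orthonormal_basis mu B by exact: heis_basis_orthonormal.
have mu_lor : lorentzian mu by exact: heis_metric_lorentzian.
have explicit : sigma_eq1 ->
    represented_by B Ric (diag_last n (lambda / 2) (- (n%:R * lambda) / 2)) /\
    exists D : {linear 'rV[R]_(n.*2.+1) -> 'rV[R]_(n.*2.+1)},
      [/\ represented_by B D
            (diag_last n (- ((n%:R + 1) * lambda) / 2) (- ((n%:R + 1) * lambda))),
          derivation br D
        & forall u, Ric u = ((n%:R + 2) * lambda / 2) *: u + D u].
  move=> s1; have h1 (i : 'I_n) : pair_weight sigma i = 1.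
    by rewrite /pair_weight; case: ifP => // lt_in; rewrite s1 ?le_pred.
  have RicE u : Ric u = u *m diag_last n (lambda / 2) (- (n%:R * lambda) / 2).
    rewrite /Ric heis_ricci // !mul_mx_diag; apply/rowP => j; rewrite !mxE.
    congr (_ * _); case: (heis_idxP j) => [i|i|].
    - by rewrite fidx_neq_max weight_f h1 expr1n divr1.
    - by rewrite gidx_neq_max weight_g h1 expr1n divr1.
    rewrite eqxx (eq_bigr (fun=> 1)) => [|i _]; last by rewrite h1 expr1n invr1.
    by rewrite sumr_const card_ord; field.
  split; first exact: represented_by_diag.
  exists (mulmxr (diag_last n (- ((n%:R + 1) * lambda) / 2)
                              (- ((n%:R + 1) * lambda)))); split.
  - exact: represented_by_diag.
  - apply: diag_derivation => i.
    by rewrite !mxE fidx_neq_max gidx_neq_max eqxx; field.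
  - move=> u; rewrite RicE /= !mul_mx_diag; apply/rowP => j; rewrite !mxE.
    by case: ifP => _; field.
split=> //; split=> [[_ [e [e_onb [eta [D [D_der DE]]]]]]|s1]; last first.
  have [_ [D [_ D_der DE]]] := explicit s1.
  by split=> //; exists B; split=> //; exists ((n%:R + 2) * lambda / 2), D.
have [_ _ mu_nondeg _] := mu_lor.
(* The eigenvalues of [Ric - eta Id], which is the derivation [D]: the Ricci
   operator may be computed in the basis [B] instead of [e]. *)
pose rz := - (lambda / 2 * \sum_(i < n) (pair_weight sigma i ^+ 2)^-1) - eta.
pose r : 'rV[R]_n.*2.+1 := \row_j if j == ord_max then rz
  else lambda / 2 / heis_weight sigma lambda j ^+ 2 - eta.
have DrE u : D u = u *m diag_mx r.
  have := DE u; rewrite (ricci_indep _ _ e_onb B_onb) // => /eqP.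
  rewrite heis_ricci // [eta *: u + _]addrC -subr_eq => /eqP <-.
  rewrite !mul_mx_diag; apply/rowP => j; rewrite !mxE.
  by rewrite /rz; case: ifP => _; ring.
have hE (i : 'I_n) : lambda / pair_weight sigma i ^+ 2 = rz + eta + eta.
  have := derivation_pair _ _ i D_der DrE.
  rewrite !mxE fidx_neq_max gidx_neq_max eqxx weight_f weight_g => rzE.
  by rewrite -rzE; field; rewrite gt_eqF.
(* The last pair has weight 1, which makes the constant of [hE] equal to
   [lambda]. *)
have h1 (i : 'I_n) : pair_weight sigma i = 1.
  have lt_n : (n.-1 < n)%N by rewrite prednK.
  have hn : pair_weight sigma (Ordinal lt_n) = 1.
    by rewrite /pair_weight /= prednK // ltnn.
  have : lambda / pair_weight sigma i ^+ 2 = lambda.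
    by rewrite hE -(hE (Ordinal lt_n)) hn expr1n divr1.
  move/(canRL (mulKf (lt0r_neq0 lambda_gt0))).
  rewrite mulVf ?gt_eqF // => /eqP; rewrite invr_eq1 sqrf_eq1.
  by case/orP => /eqP // hi; have := h_gt0 i; rewrite hi oppr_gt0 ltr10.
move=> [|k]; rewrite // le_pred => /andP[_ lt_kn].
by have := h1 (Ordinal (ltnW lt_kn)); rewrite /pair_weight /= lt_kn.
Qed.
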